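(* Let $(\mathcal{C},\otimes,I,\alpha,\lambda,\rho)$ be a monoidal category with exponentials, i.e. for every object $A$ the functor $-\otimes A:\mathcal{C}\to\mathcal{C}$ has a right adjoint. If $\mathcal{C}$ has binary coproducts, and for each object $A$ of $\mathcal{C}$ the initial algebra of the endofunctor $X\mapsto I+A\otimes X$ exists, then for each object $A$ of $\mathcal{C}$ the free monoid $A^*$ on $A$ exists and its carrier is given by $\mu X.\ I+A\otimes X$, the carrier of the initial algebra of $X\mapsto I+A\otimes X$.
   Context: A monoid in a monoidal category is an object $M$ with morphisms $m:M\otimes M\to M$ and $e:I\to M$ satisfying the associativity and unit laws; a monoid homomorphism $(M_1,m_1,e_1)\to(M_2,m_2,e_2)$ is a morphism $f:M_1\to M_2$ with $f\circ e_1=e_2$ and $f\circ m_1=m_2\circ(f\otimes f)$. The free monoid on an object $A$ is a monoid $(F,m_F,e_F)$ together with a morphism $\mathrm{ins}:A\to F$ such that for every monoid $(G,m_G,e_G)$ and every morphism $f:A\to G$ in $\mathcal{C}$ there is a unique monoid homomorphism $\mathrm{free}\,f:F\to G$ with $(\mathrm{free}\,f)\circ\mathrm{ins}=f$. *)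

(* Defs.v *)
Set Implicit Arguments.
Unset Strict Implicit.
Unset Printing Implicit Defensive.

Declare Scope cat_scope.
Delimit Scope cat_scope with cat.
Local Open Scope cat_scope.

Record category := Category {
  obj :> Type;
  hom : obj -> obj -> Type;
  idm : forall X : obj, hom X X;
  comp : forall X Y Z : obj, hom Y Z -> hom X Y -> hom X Z;
  comp_idl : forall (X Y : obj) (f : hom X Y), comp (idm Y) f = f;
  comp_idr : forall (X Y : obj) (f : hom X Y), comp f (idm X) = f;
  comp_assoc : forall (W X Y Z : obj)
      (h : hom Y Z) (g : hom X Y) (f : hom W X),
    comp h (comp g f) = comp (comp h g) f
}.

Arguments hom {c} X Y.
Arguments idm {c} X.
Arguments comp {c X Y Z} g f.

Notation "g ∘ f" := (comp g f) (at level 40, left associativity) : cat_scope.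

Record iso (C : category) (X Y : C) := Iso {
  iso_fwd :> hom X Y;
  iso_bwd : hom Y X;
  iso_fwdK : iso_bwd ∘ iso_fwd = idm X;
  iso_bwdK : iso_fwd ∘ iso_bwd = idm Y
}.

Record functor (C D : category) := Functor {
  fobj :> C -> D;
  fmap : forall X Y : C, hom X Y -> hom (fobj X) (fobj Y);
  fmap_id : forall X : C, fmap (idm X) = idm (fobj X);
  fmap_comp : forall (X Y Z : C) (g : hom Y Z) (f : hom X Y),
    fmap (g ∘ f) = fmap g ∘ fmap f
}.

Arguments fmap {C D} F {X Y} f : rename.

Definition prod_category (C D : category) : category.
Proof.
refine (@Category (C * D)%type
  (fun X Y => (hom (fst X) (fst Y) * hom (snd X) (snd Y))%type)
  (fun X => (idm (fst X), idm (snd X)))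
  (fun X Y Z g f => (fst g ∘ fst f, snd g ∘ snd f)) _ _ _).
- intros X Y [f1 f2]; simpl; now rewrite !comp_idl.
- intros X Y [f1 f2]; simpl; now rewrite !comp_idr.
- intros W X Y Z h g f; simpl; now rewrite !comp_assoc.
Defined.

(* [adjunction F G] says that F is left adjoint to G. *)
Record adjunction (C D : category) (F : functor C D) (G : functor D C) :=
  Adjunction {
  transpose : forall (X : C) (Y : D), hom (F X) Y -> hom X (G Y);
  untranspose : forall (X : C) (Y : D), hom X (G Y) -> hom (F X) Y;
  transposeK : forall (X : C) (Y : D) (f : hom (F X) Y),
    untranspose (transpose f) = f;
  untransposeK : forall (X : C) (Y : D) (g : hom X (G Y)),
    transpose (untranspose g) = g;
  transpose_natural : forall (X X' : C) (Y Y' : D)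
      (u : hom X' X) (f : hom (F X) Y) (v : hom Y Y'),
    transpose (v ∘ f ∘ fmap F u) = fmap G v ∘ transpose f ∘ u
}.

Definition has_right_adjoint (C D : category) (F : functor C D) : Prop :=
  exists G : functor D C, inhabited (adjunction F G).

Record binary_coproducts (C : category) := BinaryCoproducts {
  coprod : C -> C -> C;
  inj1 : forall X Y : C, hom X (coprod X Y);
  inj2 : forall X Y : C, hom Y (coprod X Y);
  copair : forall X Y Z : C, hom X Z -> hom Y Z -> hom (coprod X Y) Z;
  copair_inj1 : forall (X Y Z : C) (f : hom X Z) (g : hom Y Z),
    copair f g ∘ inj1 X Y = f;
  copair_inj2 : forall (X Y Z : C) (f : hom X Z) (g : hom Y Z),
    copair f g ∘ inj2 X Y = g;
  copair_unique : forall (X Y Z : C) (f : hom X Z) (g : hom Y Z)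
      (h : hom (coprod X Y) Z),
    h ∘ inj1 X Y = f -> h ∘ inj2 X Y = g -> h = copair f g
}.

Arguments inj1 {C} b X Y.
Arguments inj2 {C} b X Y.
Arguments copair {C} b {X Y Z} f g.

Definition coprod_map (C : category) (P : binary_coproducts C)
    (X X' Y Y' : C) (f : hom X X') (g : hom Y Y') :
    hom (coprod P X Y) (coprod P X' Y') :=
  copair P (inj1 P X' Y' ∘ f) (inj2 P X' Y' ∘ g).

Lemma coprod_map_id (C : category) (P : binary_coproducts C) (X Y : C) :
  coprod_map P (idm X) (idm Y) = idm (coprod P X Y).
Proof.
symmetry; apply copair_unique; now rewrite comp_idl, comp_idr.
Qed.

Lemma coprod_map_comp (C : category) (P : binary_coproducts C)
    (X X' X'' Y Y' Y'' : C) (f' : hom X' X'') (f : hom X X')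
    (g' : hom Y' Y'') (g : hom Y Y') :
  coprod_map P (f' ∘ f) (g' ∘ g) = coprod_map P f' g' ∘ coprod_map P f g.
Proof.
symmetry; unfold coprod_map; apply copair_unique; rewrite <- comp_assoc.
- now rewrite copair_inj1, !comp_assoc, copair_inj1.
- now rewrite copair_inj2, !comp_assoc, copair_inj2.
Qed.

Record algebra (C : category) (F : functor C C) := Algebra {
  alg_carrier : C;
  alg_map : hom (F alg_carrier) alg_carrier
}.

Definition is_algebra_hom (C : category) (F : functor C C) (S T : algebra F)
    (h : hom (alg_carrier S) (alg_carrier T)) : Prop :=
  h ∘ alg_map S = alg_map T ∘ fmap F h.

Record initial_algebra (C : category) (F : functor C C) := InitialAlgebra {
  init_alg :> algebra F;
  init_universal : forall T : algebra F,
    exists! h : hom (alg_carrier init_alg) (alg_carrier T),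
      is_algebra_hom h
}.

Record monoidal_data := MonoidalData {
  base_category :> category;
  tensor : functor (prod_category base_category base_category) base_category;
  unit_obj : base_category;
  associator : forall X Y Z : base_category,
    iso (tensor (tensor (X, Y), Z)) (tensor (X, tensor (Y, Z)));
  left_unitor : forall X : base_category, iso (tensor (unit_obj, X)) X;
  right_unitor : forall X : base_category, iso (tensor (X, unit_obj)) X
}.

Arguments unit_obj {m}.
Arguments associator {m} X Y Z.
Arguments left_unitor {m} X.
Arguments right_unitor {m} X.

Definition tens_obj (C : monoidal_data) (X Y : C) : C := tensor C (X, Y).

Definition tens_map (C : monoidal_data) (X X' Y Y' : C)
    (f : hom X X') (g : hom Y Y') : hom (tens_obj X Y) (tens_obj X' Y') :=
  @fmap _ _ (tensor C) (X, Y) (X', Y') (f, g).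

Notation "X ⊗ Y" := (tens_obj X Y)
  (at level 30, right associativity) : cat_scope.
Notation "f ⊠ g" := (tens_map f g)
  (at level 30, right associativity) : cat_scope.

Record monoidal_category := MonoidalCategory {
  mon_data :> monoidal_data;
  associator_natural : forall (X X' Y Y' Z Z' : mon_data)
      (f : hom X X') (g : hom Y Y') (h : hom Z Z'),
    associator X' Y' Z' ∘ ((f ⊠ g) ⊠ h) = (f ⊠ (g ⊠ h)) ∘ associator X Y Z;
  left_unitor_natural : forall (X X' : mon_data) (f : hom X X'),
    left_unitor X' ∘ (idm unit_obj ⊠ f) = f ∘ left_unitor X;
  right_unitor_natural : forall (X X' : mon_data) (f : hom X X'),
    right_unitor X' ∘ (f ⊠ idm unit_obj) = f ∘ right_unitor X;
  triangle : forall X Y : mon_data,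
    (idm X ⊠ left_unitor Y) ∘ associator X unit_obj Y
      = right_unitor X ⊠ idm Y;
  pentagon : forall W X Y Z : mon_data,
    associator W X (Y ⊗ Z) ∘ associator (W ⊗ X) Y Z
      = (idm W ⊠ associator X Y Z) ∘ associator W (X ⊗ Y) Z
          ∘ (associator W X Y ⊠ idm Z)
}.

Lemma tens_map_id (C : monoidal_data) (X Y : C) :
  idm X ⊠ idm Y = idm (X ⊗ Y).
Proof. exact (fmap_id (tensor C) (X, Y)). Qed.

Lemma tens_map_comp (C : monoidal_data) (X X' X'' Y Y' Y'' : C)
    (f' : hom X' X'') (f : hom X X') (g' : hom Y' Y'') (g : hom Y Y') :
  (f' ∘ f) ⊠ (g' ∘ g) = (f' ⊠ g') ∘ (f ⊠ g).
Proof.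
exact (@fmap_comp _ _ (tensor C) (X, Y) (X', Y') (X'', Y'') (f', g') (f, g)).
Qed.

Definition tensor_right (C : monoidal_data) (A : C) : functor C C.
Proof.
refine (@Functor C C (fun X => X ⊗ A) (fun X Y f => f ⊠ idm A) _ _).
- intros X; apply tens_map_id.
- intros X Y Z g f; now rewrite <- tens_map_comp, comp_idl.
Defined.

Definition has_exponentials (C : monoidal_data) : Prop :=
  forall A : C, has_right_adjoint (tensor_right A).

(* The endofunctor X |-> I + A ⊗ X. *)
Definition list_functor (C : monoidal_data) (P : binary_coproducts C) (A : C) :
  functor C C.
Proof.
refine (@Functor C C (fun X => coprod P unit_obj (A ⊗ X))
  (fun X Y f => coprod_map P (idm unit_obj) (idm A ⊠ f)) _ _).
- intros X; now rewrite tens_map_id, coprod_map_id.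
- intros X Y Z g f.
  now rewrite <- coprod_map_comp, <- tens_map_comp, !comp_idl.
Defined.

Record monoid (C : monoidal_data) := Monoid {
  mon_carrier : C;
  mon_mul : hom (mon_carrier ⊗ mon_carrier) mon_carrier;
  mon_unit : hom unit_obj mon_carrier;
  mon_assoc :
    mon_mul ∘ (mon_mul ⊠ idm mon_carrier)
      = mon_mul ∘ (idm mon_carrier ⊠ mon_mul)
          ∘ associator mon_carrier mon_carrier mon_carrier;
  mon_unit_l :
    mon_mul ∘ (mon_unit ⊠ idm mon_carrier) = left_unitor mon_carrier;
  mon_unit_r :
    mon_mul ∘ (idm mon_carrier ⊠ mon_unit) = right_unitor mon_carrier
}.

Arguments mon_mul {C} m.
Arguments mon_unit {C} m.

Definition is_monoid_hom (C : monoidal_data) (M N : monoid C)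
    (f : hom (mon_carrier M) (mon_carrier N)) : Prop :=
  f ∘ mon_unit M = mon_unit N /\ f ∘ mon_mul M = mon_mul N ∘ (f ⊠ f).

Record free_monoid (C : monoidal_data) (A : C) := FreeMonoid {
  free_mon :> monoid C;
  ins : hom A (mon_carrier free_mon);
  free_universal : forall (G : monoid C) (f : hom A (mon_carrier G)),
    exists! h : hom (mon_carrier free_mon) (mon_carrier G),
      is_monoid_hom h /\ h ∘ ins = f
}.

(* Main.v *)
(** Write [L] for the carrier of the initial algebra, with structure maps
    [nil : I -> L] and [cons : A ⊗ L -> L].  Transposing along [- ⊗ Y ⊣ G]
    strengthens initiality to recursion with a parameter: a map [L ⊗ Y -> Z] is
    determined by, and can be freely prescribed through, its values on
    [nil ⊠ Y] and [cons ⊠ Y].  Multiplication [L ⊗ L -> L] is the parametrized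
    recursion that appends lists.  The monoid laws, and the fact that the
    algebra map [L -> G] into a monoid is multiplicative, all follow by
    uniqueness of parametrized recursion; the coherence isomorphisms enter
    through Kelly's consequences of the triangle and pentagon axioms. *)

From Corelib Require Import ssreflect.
Require Import Defs.

Set Implicit Arguments.
Unset Strict Implicit.
Unset Printing Implicit Defensive.

Local Open Scope cat_scope.

(** * Calculus of composites, isomorphisms and tensors *)

Lemma comp_whisker (C : category) (V W W' X Y : C)
    (g : hom W X) (f : hom V W) (g' : hom W' X) (f' : hom V W') :
  g ∘ f = g' ∘ f' -> forall k : hom X Y, k ∘ g ∘ f = k ∘ g' ∘ f'.
Proof. by move=> H k; rewrite -comp_assoc H comp_assoc. Qed.

Lemma iso_epi (C : category) (X Y Z : C) (i : iso X Y) (f g : hom Y Z) :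
  f ∘ i = g ∘ i -> f = g.
Proof.
move=> H; rewrite -(comp_idr f) -(comp_idr g) -(iso_bwdK i).
by rewrite !comp_assoc H.
Qed.

Lemma iso_mono (C : category) (X Y Z : C) (i : iso Y Z) (f g : hom X Y) :
  i ∘ f = i ∘ g -> f = g.
Proof.
move=> H; rewrite -(comp_idl f) -(comp_idl g) -(iso_fwdK i).
by rewrite -!comp_assoc H.
Qed.

Lemma tens_comp_idl (C : monoidal_data) (W X Y Z : C)
    (g : hom X Y) (f : hom W X) :
  idm Z ⊠ (g ∘ f) = (idm Z ⊠ g) ∘ (idm Z ⊠ f).
Proof. by rewrite -tens_map_comp comp_idl. Qed.

Lemma tens_comp_idr (C : monoidal_data) (W X Y Z : C)
    (g : hom X Y) (f : hom W X) :
  (g ∘ f) ⊠ idm Z = (g ⊠ idm Z) ∘ (f ⊠ idm Z).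
Proof. by rewrite -tens_map_comp comp_idl. Qed.

Lemma tens_swap (C : monoidal_data) (X X' Y Y' : C)
    (f : hom X X') (g : hom Y Y') :
  (f ⊠ idm Y') ∘ (idm X ⊠ g) = (idm X' ⊠ g) ∘ (f ⊠ idm Y).
Proof. by rewrite -!tens_map_comp !comp_idl !comp_idr. Qed.

Definition iso_tens_id (C : monoidal_data) (X Y Z : C) (i : iso X Y) :
  iso (X ⊗ Z) (Y ⊗ Z).
Proof.
refine (@Iso _ _ _ (i ⊠ idm Z) (iso_bwd i ⊠ idm Z) _ _);
  by rewrite -tens_comp_idr ?iso_fwdK ?iso_bwdK tens_map_id.
Defined.

Definition associator_inv (C : monoidal_data) (X Y Z : C) :
    hom (X ⊗ (Y ⊗ Z)) ((X ⊗ Y) ⊗ Z) :=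
  iso_bwd (associator X Y Z).

Lemma associatorK (C : monoidal_data) (X Y Z : C) :
  associator_inv X Y Z ∘ associator X Y Z = idm ((X ⊗ Y) ⊗ Z).
Proof. exact: iso_fwdK. Qed.

Lemma associator_invK (C : monoidal_data) (X Y Z : C) :
  associator X Y Z ∘ associator_inv X Y Z = idm (X ⊗ (Y ⊗ Z)).
Proof. exact: iso_bwdK. Qed.

Lemma associator_inv_natural (C : monoidal_category) (X X' Y Z : C)
    (f : hom X X') :
  associator_inv X' Y Z ∘ (f ⊠ idm (Y ⊗ Z))
    = ((f ⊠ idm Y) ⊠ idm Z) ∘ associator_inv X Y Z.
Proof.
apply: (@iso_mono _ _ _ _ (associator X' Y Z)).
rewrite !comp_assoc associator_invK comp_idl associator_natural tens_map_id.
by rewrite -comp_assoc associator_invK comp_idr.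
Qed.

(** * Kelly's coherence consequences of triangle and pentagon *)

Lemma tens_unit_faithful_l (C : monoidal_category) (X Y : C) (f g : hom X Y) :
  idm unit_obj ⊠ f = idm unit_obj ⊠ g -> f = g.
Proof.
move=> H; apply: (@iso_epi _ _ _ _ (left_unitor X)).
by rewrite -!left_unitor_natural H.
Qed.

Lemma tens_unit_faithful_r (C : monoidal_category) (X Y : C) (f g : hom X Y) :
  f ⊠ idm unit_obj = g ⊠ idm unit_obj -> f = g.
Proof.
move=> H; apply: (@iso_epi _ _ _ _ (right_unitor X)).
by rewrite -!right_unitor_natural H.
Qed.

(** Tensoring with [unit_obj] on the left loses nothing. After precomposition with two invertible
    associators, the pentagon at I, I, X, Y and a triangle on each side reduce both composites to
    the same map. *)
Lemma left_unitor_tens (C : monoidal_category) (X Y : C) :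
  left_unitor (X ⊗ Y) ∘ associator unit_obj X Y = left_unitor X ⊠ idm Y.
Proof.
apply: tens_unit_faithful_l.
apply: (@iso_epi _ _ _ _ (associator unit_obj (unit_obj ⊗ X) Y)).
apply: (@iso_epi _ _ _ _ (iso_tens_id Y (associator unit_obj unit_obj X))).
rewrite tens_comp_idl /=.
transitivity ((idm unit_obj ⊠ left_unitor (X ⊗ Y)) ∘
  (associator unit_obj unit_obj (X ⊗ Y)
     ∘ associator (unit_obj ⊗ unit_obj) X Y)).
  by rewrite pentagon !comp_assoc.
rewrite comp_assoc triangle -associator_natural -tens_map_id.
by rewrite -associator_natural -comp_assoc -tens_comp_idr triangle.
Qed.

(** The mirror argument: tensor with [unit_obj] on the right and use the pentagon at X, Y, I, I. *)
Lemma right_unitor_tens (C : monoidal_category) (X Y : C) :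
  (idm X ⊠ right_unitor Y) ∘ associator X Y unit_obj = right_unitor (X ⊗ Y).
Proof.
apply: tens_unit_faithful_r.
apply: (@iso_mono _ _ _ _ (associator X Y unit_obj)).
rewrite tens_comp_idr comp_assoc associator_natural -!triangle.
rewrite tens_comp_idl comp_assoc -tens_map_id associator_natural.
by rewrite -!comp_assoc pentagon !comp_assoc.
Qed.

Lemma left_unitor_unit (C : monoidal_category) :
  left_unitor unit_obj = right_unitor unit_obj
    :> hom (unit_obj ⊗ unit_obj) (@unit_obj C).
Proof.
apply: tens_unit_faithful_r.
rewrite -left_unitor_tens -triangle; congr (_ ∘ _).
(* What remains, that the left unitor at I ⊗ I is [idm unit_obj ⊠ left_unitor unit_obj], is
   naturality of the unitor at itself, cancelled by the unitor. *)
apply: (@iso_mono _ _ _ _ (left_unitor unit_obj)).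
by rewrite left_unitor_natural.
Qed.

(** * List objects, plain and with a parameter *)

Definition is_list_object (C : monoidal_data) (A L : C)
    (nil : hom unit_obj L) (cons : hom (A ⊗ L) L) : Prop :=
  forall (Z : C) (n : hom unit_obj Z) (c : hom (A ⊗ Z) Z),
    exists! h : hom L Z, h ∘ nil = n /\ h ∘ cons = c ∘ (idm A ⊠ h).

Definition is_parametrized_list_object (C : monoidal_data) (A L : C)
    (nil : hom unit_obj L) (cons : hom (A ⊗ L) L) : Prop :=
  forall (Y Z : C) (n : hom Y Z) (c : hom (A ⊗ Z) Z),
    exists! h : hom (L ⊗ Y) Z,
      h ∘ (nil ⊠ idm Y) = n ∘ left_unitor Y /\
      h ∘ (cons ⊠ idm Y) = c ∘ (idm A ⊠ h) ∘ associator A L Y.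

(** A map out of I + A ⊗ X is a pair of maps, so algebras on Z are pairs [n], [c], and the
    homomorphism square splits along the two injections. *)
Lemma initial_list_object (C : monoidal_data) (P : binary_coproducts C) (A : C)
    (mu : initial_algebra (list_functor P A)) :
  is_list_object (alg_map mu ∘ inj1 P unit_obj (A ⊗ alg_carrier mu))
    (alg_map mu ∘ inj2 P unit_obj (A ⊗ alg_carrier mu)).
Proof.
move=> Z n c.
pose T := @Algebra _ (list_functor P A) Z (copair P n c).
have homE (h : hom (alg_carrier mu) Z) :
    @is_algebra_hom _ _ mu T h <->
    h ∘ (alg_map mu ∘ inj1 P unit_obj (A ⊗ alg_carrier mu)) = n /\
    h ∘ (alg_map mu ∘ inj2 P unit_obj (A ⊗ alg_carrier mu))
      = c ∘ (idm A ⊠ h).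
  have E1 : copair P n c ∘ coprod_map P (idm unit_obj) (idm A ⊠ h)
      ∘ inj1 P unit_obj (A ⊗ alg_carrier mu) = n.
    by rewrite -comp_assoc copair_inj1 comp_idr copair_inj1.
  have E2 : copair P n c ∘ coprod_map P (idm unit_obj) (idm A ⊠ h)
      ∘ inj2 P unit_obj (A ⊗ alg_carrier mu) = c ∘ (idm A ⊠ h).
    by rewrite -comp_assoc copair_inj2 comp_assoc copair_inj2.
  rewrite !comp_assoc; split=> [H|[H1 H2]].
    by rewrite H /= E1 E2.
  rewrite /is_algebra_hom /=.
  by rewrite (copair_unique H1 H2) -(copair_unique E1 E2).
have [h [Hh U]] := init_universal mu T.
exists h; split; first exact/homE.
by move=> h' /homE; apply: U.
Qed.

Section Adjunction.

Context (C D : category) (F : functor C D) (G : functor D C).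
Context (adj : adjunction F G).

Lemma transpose_precomp (X X' : C) (Y : D) (f : hom (F X) Y) (u : hom X' X) :
  transpose adj (f ∘ fmap F u) = transpose adj f ∘ u.
Proof.
have := transpose_natural adj u f (idm Y).
by rewrite comp_idl fmap_id comp_idl.
Qed.

Lemma transpose_inj (X : C) (Y : D) (f g : hom (F X) Y) :
  transpose adj f = transpose adj g -> f = g.
Proof. by move=> H; rewrite -(transposeK adj f) H transposeK. Qed.

Definition counit (Y : D) : hom (F (G Y)) Y := untranspose adj (idm (G Y)).

Lemma counit_transpose (X : C) (Y : D) (f : hom (F X) Y) :
  counit Y ∘ fmap F (transpose adj f) = f.
Proof.
by apply: transpose_inj; rewrite transpose_precomp untransposeK comp_idl.
Qed.

End Adjunction.

(** Plain recursion is applied with the exponential [G Z] as target: transposing [n] and [c] makes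
    [G Z] an algebra, and transposition matches solutions [h] on L ⊗ Y with algebra maps [g] into
    [G Z]. *)
Lemma list_object_parametrized (C : monoidal_category) (A L : C)
    (nil : hom unit_obj L) (cons : hom (A ⊗ L) L) :
  has_exponentials C -> is_list_object nil cons ->
  is_parametrized_list_object nil cons.
Proof.
move=> expC listL Y Z n c.
have [G [adj]] := expC Y.
pose ev : hom (G Z ⊗ Y) Z := counit adj Z.
pose n' := transpose adj (n ∘ left_unitor Y : hom (tensor_right Y unit_obj) Z).
(* The step on [G Z]: reassociate, evaluate at the parameter, then apply [c]. *)
pose c' := transpose adj
  (c ∘ (idm A ⊠ ev) ∘ associator A (G Z) Y : hom (tensor_right Y (A ⊗ G Z)) Z).
have recE (h : hom (L ⊗ Y) Z) (g := transpose adj (h : hom (tensor_right Y L) Z)) :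
    (h ∘ (nil ⊠ idm Y) = n ∘ left_unitor Y /\
     h ∘ (cons ⊠ idm Y) = c ∘ (idm A ⊠ h) ∘ associator A L Y) <->
    (g ∘ nil = n' /\ g ∘ cons = c' ∘ (idm A ⊠ g)).
  have hE : h = ev ∘ (g ⊠ idm Y).
    by symmetry; apply: (counit_transpose adj (h : hom (tensor_right Y L) Z)).
  have E1 : g ∘ nil = transpose adj (h ∘ (nil ⊠ idm Y) : hom (tensor_right Y _) Z).
    by symmetry; apply: transpose_precomp.
  have E2 : g ∘ cons = transpose adj (h ∘ (cons ⊠ idm Y) : hom (tensor_right Y _) Z).
    by symmetry; apply: transpose_precomp.
  have E3 : c' ∘ (idm A ⊠ g) = transpose adj
      (c ∘ (idm A ⊠ h) ∘ associator A L Y : hom (tensor_right Y _) Z).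
    rewrite /c' -transpose_precomp /= hE tens_comp_idl.
    congr (transpose adj _).
    by rewrite comp_assoc -!(comp_assoc (c ∘ _)) associator_natural.
  rewrite E1 E2 E3; split=> [[-> ->] //|[H1 H2]].
  by split; [apply: transpose_inj H1 | apply: transpose_inj H2].
have [g [Hg U]] := listL (G Z) n' c'.
exists (untranspose adj g); split.
  by apply/recE; rewrite untransposeK.
move=> h /recE /U ->.
exact: (transposeK adj (h : hom (tensor_right Y L) Z)).
Qed.

Lemma parametrized_list_eq (C : monoidal_data) (A L : C)
    (nil : hom unit_obj L) (cons : hom (A ⊗ L) L)
    (recL : is_parametrized_list_object nil cons)
    (Y Z : C) (n : hom Y Z) (c : hom (A ⊗ Z) Z) (h k : hom (L ⊗ Y) Z) :
  h ∘ (nil ⊠ idm Y) = n ∘ left_unitor Y ->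
  h ∘ (cons ⊠ idm Y) = c ∘ (idm A ⊠ h) ∘ associator A L Y ->
  k ∘ (nil ⊠ idm Y) = n ∘ left_unitor Y ->
  k ∘ (cons ⊠ idm Y) = c ∘ (idm A ⊠ k) ∘ associator A L Y ->
  h = k.
Proof.
move=> h1 h2 k1 k2; have [r [_ U]] := recL Y Z n c.
by rewrite -(U h) // -(U k).
Qed.

(** * The monoid of lists under append and its freeness *)

Section FreeMonoid.

Context (C : monoidal_category) (A L : C).
Context (nil : hom unit_obj L) (cons : hom (A ⊗ L) L).
Context (recL : is_parametrized_list_object nil cons).
Context (m : hom (L ⊗ L) L).
Context (m_nil : m ∘ (nil ⊠ idm L) = left_unitor L).
Context (m_cons :
  m ∘ (cons ⊠ idm L) = cons ∘ (idm A ⊠ m) ∘ associator A L L).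

(** Both sides solve the recursion with parameter I, base [nil] and step [cons]. For the right
    unitor, the base case is [left_unitor_unit] and the step is [right_unitor_tens]. *)
Lemma append_nil : m ∘ (idm L ⊠ nil) = right_unitor L.
Proof.
apply: (parametrized_list_eq recL (n := nil) (c := cons)).
- by rewrite -comp_assoc -tens_swap comp_assoc m_nil left_unitor_natural.
- rewrite -comp_assoc -tens_swap comp_assoc m_cons tens_comp_idl.
  rewrite !comp_assoc -!(comp_assoc (cons ∘ _)) -associator_natural.
  by rewrite tens_map_id.
- by rewrite right_unitor_natural left_unitor_unit.
- by rewrite right_unitor_natural -right_unitor_tens comp_assoc.
Qed.

Lemma append_assoc :
  m ∘ (m ⊠ idm L) = m ∘ (idm L ⊠ m) ∘ associator L L L.
Proof.
(* The associator changes sides so that both maps start from L ⊗ (L ⊗ L), the shape of a recursion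
   with parameter L ⊗ L; its base is [m] and its step [cons]. *)
suff -> : m ∘ (idm L ⊠ m)
    = m ∘ (m ⊠ idm L) ∘ associator_inv L L L.
  by rewrite -!comp_assoc associatorK comp_idr.
apply: (parametrized_list_eq recL (n := m) (c := cons)).
- by rewrite -comp_assoc -tens_swap comp_assoc m_nil left_unitor_natural.
- rewrite -comp_assoc -tens_swap comp_assoc m_cons tens_comp_idl.
  rewrite !comp_assoc -!(comp_assoc (cons ∘ _)) -associator_natural.
  by rewrite tens_map_id.
- rewrite -comp_assoc associator_inv_natural comp_assoc -(comp_assoc m).
  rewrite -tens_comp_idr m_nil -left_unitor_tens.
  by rewrite -!comp_assoc associator_invK comp_idr.
- rewrite -comp_assoc associator_inv_natural comp_assoc -(comp_assoc m).
  rewrite -tens_comp_idr m_cons.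
  rewrite !tens_comp_idr !comp_assoc m_cons.
  rewrite (comp_whisker (associator_natural _ _ _)).
  rewrite -(comp_assoc cons (idm A ⊠ m) (idm A ⊠ (m ⊠ idm L))) -tens_comp_idl.
  (* This precomposition cancels the inverse associator on the left and exposes the pentagon at A,
     L, L, L on the right. *)
  apply: (@iso_epi _ _ _ _ (associator (A ⊗ L) L L)).
  rewrite -(comp_assoc _ _ (associator (A ⊗ L) L L)) associatorK comp_idr.
  rewrite -!(comp_assoc _ (associator A L (L ⊗ L))) pentagon.
  rewrite !comp_assoc; congr (_ ∘ _ ∘ _).
  rewrite -!comp_assoc -tens_comp_idl; congr (_ ∘ (_ ⊠ _)).
  by rewrite -!comp_assoc associatorK comp_idr.
Qed.

Definition list_monoid : monoid C :=
  Monoid append_assoc m_nil append_nil.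

Definition singleton : hom A L :=
  cons ∘ (idm A ⊠ nil) ∘ iso_bwd (right_unitor A).

(** Recovers [cons] from the multiplication and the insertion of generators, which is what forces a
    monoid homomorphism to be a fold. *)
Lemma append_singleton : m ∘ (singleton ⊠ idm L) = cons.
Proof.
rewrite /singleton !tens_comp_idr !comp_assoc m_cons.
rewrite (comp_whisker (associator_natural _ _ _)).
rewrite -(comp_assoc cons) -tens_comp_idl m_nil -(comp_assoc cons) triangle.
by rewrite -comp_assoc -tens_comp_idr iso_bwdK tens_map_id comp_idr.
Qed.

Lemma list_monoid_free (listL : is_list_object nil cons)
    (G : monoid C) (f : hom A (mon_carrier G)) :
  exists! h : hom L (mon_carrier G),
    @is_monoid_hom _ list_monoid G h /\ h ∘ singleton = f.
Proof.
(* The extension of [f] is the fold that starts at the unit of [G] and multiplies on the left by the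
   image of each letter. *)
have [h [[h_nil h_cons] U]] :=
  listL _ (mon_unit G) (mon_mul G ∘ (f ⊠ idm (mon_carrier G))).
have fold_cons (k : hom L (mon_carrier G)) :
    mon_mul G ∘ (f ⊠ idm _) ∘ (idm A ⊠ k) = mon_mul G ∘ (f ⊠ k).
  by rewrite -comp_assoc -tens_map_comp comp_idl comp_idr.
rewrite fold_cons in h_cons.
exists h; split; last first.
  (* Uniqueness: rewriting [cons] as appending a singleton shows that [k] satisfies the equations of
     the fold. *)
  move=> k [[k_nil k_mul] k_ins]; apply: U; split=> //.
  rewrite fold_cons -append_singleton comp_assoc k_mul -comp_assoc.
  by rewrite -tens_map_comp k_ins comp_idr.
split; first split=> //=.
(* Multiplicativity: [h ∘ m] and [mon_mul G ∘ (h ⊠ h)] solve the same recursion with parameter L;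
   for the latter, the base uses the left unit law of [G] and the step its associativity. *)
- apply: (parametrized_list_eq recL (n := h)
      (c := mon_mul G ∘ (f ⊠ idm (mon_carrier G)))).
  + by rewrite -comp_assoc m_nil.
  + rewrite -comp_assoc m_cons !comp_assoc h_cons.
    by rewrite -!(comp_assoc (mon_mul G)) -!tens_map_comp comp_idl comp_idr.
  + rewrite -comp_assoc -tens_map_comp h_nil comp_idr.
    rewrite -{1}(comp_idr (mon_unit G)) -{1}(comp_idl h) tens_map_comp.
    by rewrite comp_assoc mon_unit_l left_unitor_natural.
  + rewrite -comp_assoc -tens_map_comp h_cons comp_idr.
    rewrite -{2}(comp_idl h) tens_map_comp comp_assoc mon_assoc.
    rewrite (comp_whisker (associator_natural _ _ _)); congr (_ ∘ _).
    by rewrite -!(comp_assoc (mon_mul G)) -!tens_map_comp !comp_idl comp_idr.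
- rewrite /singleton !comp_assoc h_cons -(comp_assoc (mon_mul G)).
  rewrite -tens_map_comp comp_idr h_nil.
  rewrite -{1}(comp_idl f) -(comp_idr (mon_unit G)) tens_map_comp comp_assoc.
  by rewrite mon_unit_r right_unitor_natural -comp_assoc iso_bwdK comp_idr.
Qed.

End FreeMonoid.

Theorem proposition2p7 (C : monoidal_category)
    (exponentials : has_exponentials C)
    (coproducts : binary_coproducts C)
    (mu : forall A : C, initial_algebra (list_functor coproducts A))
    (A : C) :
  exists Astar : free_monoid A, mon_carrier Astar = alg_carrier (mu A).
Proof.
have listL := initial_list_object (mu A).
have recL := list_object_parametrized exponentials listL.
(* Append is the recursion in its first argument with the second as parameter: base the identity,
   step [cons]. *)
have [m [[]]] := recL _ _ (idm _) (alg_map (mu A) ∘ inj2 _ _ _).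
rewrite comp_idl => m_nil m_cons _.
by exists (@FreeMonoid _ _ (list_monoid recL m_nil m_cons) _
  (list_monoid_free recL m_nil m_cons listL)).
Qed.
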